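(* Given $x^*\in\mathbb{S}$, $y^*\in\mathbb{R}^m$ and $\beta>0$, $x^*$ is a strong $\beta$-Lagrangian stationary point, with Lagrangian multiplier $y^*$, of the problem $\min_{x\in\mathbb{R}^n} f(x)$ subject to $h(x)=0$, $x\in\mathbb{S}$, if and only if $F(x^*,y^*;T)=0$ for every $T\in\mathbb{T}(x^*,y^*;\beta)$. Moreover, in this case, $\mathbb{T}(x^*,y^*;\beta)=\mathcal{J}_s(x^* )$.
   Context: Let $n,m,s$ be positive integers with $0<s<n$; $f:\mathbb{R}^n\to\mathbb{R}$ and $h:\mathbb{R}^n\to\mathbb{R}^m$ are twice continuously differentiable. $\|x\|_0$ is the number of nonzero components of $x$, $\mathbb{S}=\{x\in\mathbb{R}^n:\|x\|_0\le s\}$, $\mathrm{supp}(x)=\{i:x_i\neq0\}$, $\mathcal{J}_s=\{J\subseteq\{1,\dots,n\}:|J|=s\}$, $\mathcal{J}_s(x)=\{J\in\mathcal{J}_s:\mathrm{supp}(x)\subseteq J\}$; $T^c=\{1,\dots,n\}\setminus T$; $x_T$ is the subvector of $x$ indexed by $T$. Lagrangian: $L(x,y)=f(x)-\langle y,h(x)\rangle$, with $\nabla_xL$ its gradient in $x$. $\Pi_{\mathbb{S}}(z)=\arg\min_{w\in\mathbb{S}}\|z-w\|^2$ (in general a set). For $\beta>0$, $x^*$ is a strong $\beta$-Lagrangian stationary point with Lagrangian multiplier $y^*\in\mathbb{R}^m$ if $x^*=\Pi_{\mathbb{S}}(x^*-\beta\nabla_xL(x^*,y^* ))$ (meaning the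 projection set is the singleton $\{x^*\}$) and $h(x^* )=0$. For $x\in\mathbb{S}$, $y\in\mathbb{R}^m$, $\beta>0$, put $u=x-\beta\nabla_xL(x,y)$ and $$\mathbb{T}(x,y;\beta)=\{T\in\mathcal{J}_s:\ |u_i|\ge|u_j|\ \ \forall i\in T,\ \forall j\in T^c\}.$$ For $T\in\mathcal{J}_s$, $$F(x,y;T)=\begin{bmatrix}(\nabla_xL(x,y))_T\\ x_{T^c}\\ -h(x)\end{bmatrix}.$$ *)

(* Defs.v *)
From HB Require Import structures.
From mathcomp Require Import all_boot all_order all_algebra.
From mathcomp Require Import all_classical all_reals all_analysis.

Set Implicit Arguments.
Unset Strict Implicit.
Unset Printing Implicit Defensive.

Import Order.TTheory GRing.Theory Num.Theory.
Import numFieldNormedType.Exports.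

Local Open Scope ring_scope.

Section Smoothness.
Context {R : realType} {n : nat} {W : normedModType R}.
Implicit Type g : 'rV[R]_n -> W.

(* On R^n, continuity of x |-> 'd g x in operator norm amounts to continuity of
   x |-> 'd g x v for each fixed v, i.e., of every directional derivative. *)
Definition is_C1 g : Prop :=
  (forall x, differentiable g x) /\ (forall v, continuous ('D_v g)).

Definition is_C2 g : Prop := is_C1 g /\ (forall v, is_C1 ('D_v g)).

End Smoothness.

Section SparseOptimization.
Context {R : realType} {n m : nat}.
Implicit Types (x z w : 'rV[R]_n) (y : 'rV[R]_m) (beta : R) (T : {set 'I_n}).
Implicit Types (f : 'rV[R]_n -> R) (h : 'rV[R]_n -> 'rV[R]_m) (s : nat).

Definition gradient f x : 'rV[R]_n := \row_i 'D_(delta_mx 0 i) f x.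

Definition dotp {k : nat} (u v : 'rV[R]_k) : R := \sum_i u 0 i * v 0 i.

(* The library norm on matrices is the sup norm, not the Euclidean one. *)
Definition sqnorm2 {k : nat} (u : 'rV[R]_k) : R := dotp u u.

Definition supp x : {set 'I_n} := [set i | x 0 i != 0].

Definition norm0 x : nat := #|supp x|.

Definition sparse s : set 'rV[R]_n := [set x | (norm0 x <= s)%N]%classic.

Definition Js s : {set {set 'I_n}} := [set J : {set 'I_n} | #|J| == s].

Definition Jsx s x : {set {set 'I_n}} := [set J in Js s | supp x \subset J].

Definition lagrangian f h x y : R := f x - dotp y (h x).

Definition grad_lagrangian f h x y : 'rV[R]_n :=
  gradient (fun z => lagrangian f h z y) x.

Definition proj_sparse s z : set 'rV[R]_n :=
  [set w | sparse s w /\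
           forall v, sparse s v -> sqnorm2 (z - w) <= sqnorm2 (z - v)]%classic.

Definition strong_stationary f h s beta x y : Prop :=
  proj_sparse s (x - beta *: grad_lagrangian f h x y) = [set x]%classic
  /\ h x = 0.

Definition TT f h s x y beta : {set {set 'I_n}} :=
  let u := x - beta *: grad_lagrangian f h x y in
  [set T in Js s | [forall i in T, forall j in ~: T, `|u 0 j| <= `|u 0 i|]].

Definition subvec T x : 'rV[R]_#|T| := \row_k x 0 (enum_val k).

Definition FF f h x y T : 'rV[R]_(#|T| + #|~: T| + m) :=
  row_mx (row_mx (subvec T (grad_lagrangian f h x y)) (subvec (~: T) x))
         (- h x).

End SparseOptimization.

(* Main.v *)
Require Import Defs.
From HB Require Import structures.
From mathcomp Require Import all_boot all_order all_algebra.
From mathcomp Require Import all_classical all_reals all_analysis.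
Set Implicit Arguments.
Unset Strict Implicit.
Unset Printing Implicit Defensive.

Import Order.TTheory GRing.Theory Num.Theory.
Import numFieldNormedType.Exports.
Local Open Scope ring_scope.

(** Call an index set of size [s] a top set of [u] when no entry of [u] outside
    it is larger in modulus than an entry inside it; by an exchange argument
    these are the sets [T] of size [s] maximizing the mass [\sum_(i in T) u_i^2].
    Since [|u - v|^2 >= |u|^2 - mass T] whenever [v] is supported in [T], with
    equality only for the restriction of [u] to [T], the projections of [u] on
    the sparse vectors are exactly its restrictions to top sets.  For
    [u = x - beta g], the restriction of [u] to [T] is [x] iff [g] vanishes on
    [T] and [x] vanishes off [T], which is the equation [F(x, y; T) = 0]. *)

Lemma exists_superset_card (I : finType) (A : {set I}) k :
  (#|A| <= k <= #|I|)%N -> exists2 B : {set I}, A \subset B & #|B| = k.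
Proof.
case/andP=> leAk lekI.
(* The sets of [k - #|A|] elements disjoint from [A] are counted by a binomial coefficient, which is
   positive here; adjoining one of them to [A] gives the superset. *)
have: (0 < #|[set B : {set I} | (B \subset ~: A) && (#|B| == (k - #|A|)%N)]|)%N.
  by rewrite cards_draws bin_gt0 -(leq_add2l #|A|) cardsC subnKC.
case/card_gt0P=> B; rewrite inE => /andP[sBA /eqP cB].
exists (A :|: B); first exact: finset.subsetUl.
rewrite cardsU; have -> : A :&: B = finset.set0.
  by apply/eqP; rewrite finset.setI_eq0 disjoint_sym finset.disjoints_subset.
by rewrite cards0 subn0 cB subnKC.
Qed.

Lemma ler_sqr_norm (R : realDomainType) (a b : R) :
  (a ^+ 2 <= b ^+ 2) = (`|a| <= `|b|).
Proof.
by rewrite -[a ^+ 2]real_normK ?num_real // -[b ^+ 2]real_normK ?num_real //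
  ler_pXn2r ?nnegrE.
Qed.

Section SparseProjection.
Context {R : realType} {n : nat}.
Implicit Types (u v w x g : 'rV[R]_n) (T J : {set 'I_n}) (s : nat).

Definition restr u T : 'rV[R]_n := \row_i (if i \in T then u 0 i else 0).

Definition mass u T : R := \sum_(i in T) u 0 i ^+ 2.

(** This is [TT] with the gradient step abstracted to an arbitrary vector [u], so that the
    projection can be studied without [f] and [h]. *)
Definition top_sets s u : {set {set 'I_n}} :=
  [set T in Js s | [forall i in T, forall j in ~: T, `|u 0 j| <= `|u 0 i|]].

Lemma top_setsP s u T :
  reflect (#|T| = s /\
           forall i j, i \in T -> j \notin T -> `|u 0 j| <= `|u 0 i|)
          (T \in top_sets s u).
Proof.
rewrite !inE; apply: (iffP andP) => [[/eqP cT H]|[cT H]].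
  split=> // i j iT jT; move/forall_inP: H => /(_ i iT)/forall_inP; apply.
  by rewrite inE.
split; first exact/eqP.
by apply/forall_inP=> i iT; apply/forall_inP=> j; rewrite inE; apply: H.
Qed.

Lemma sqnorm2E u : sqnorm2 u = \sum_i u 0 i ^+ 2.
Proof. by apply: eq_bigr => i _; rewrite expr2. Qed.

Lemma sqnorm2_ge0 u : 0 <= sqnorm2 u.
Proof. by rewrite sqnorm2E; apply: sumr_ge0 => i _; exact: sqr_ge0. Qed.

Lemma sqnorm2_eq0 u : sqnorm2 u = 0 -> u = 0.
Proof.
rewrite sqnorm2E => /eqP; rewrite psumr_eq0; last by move=> i _; exact: sqr_ge0.
move/allP=> H; apply/rowP=> i; rewrite mxE; apply/eqP.
by have := H i (mem_index_enum i); rewrite sqrf_eq0.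
Qed.

(** Pythagoras for the splitting of coordinates into [T] and its complement: off [T] the vector [v]
    vanishes, so these coordinates contribute a constant independent of [v]. *)
Lemma sqnorm2_sub_supp u v T : supp v \subset T ->
  sqnorm2 (u - v) = sqnorm2 (restr u T - v) + (sqnorm2 u - mass u T).
Proof.
move=> /fintype.subsetP sv; rewrite !sqnorm2E /mass (bigID (mem T) xpredT) /=.
rewrite [\sum_i (restr u T - v) 0 i ^+ 2](bigID (mem T)) /=.
rewrite [\sum_i u 0 i ^+ 2](bigID (mem T)) /= [_ + _ - _]addrAC subrr add0r.
have v0 i : i \notin T -> v 0 i = 0.
  by apply: contraNeq => vi; apply: sv; rewrite inE.
have -> : \sum_(i | i \notin T) (restr u T - v) 0 i ^+ 2 = 0.
  by apply: big1 => i iT; rewrite !mxE (negbTE iT) v0 // subrr expr0n.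
rewrite addr0; congr (_ + _); apply: eq_bigr => i iT; rewrite !mxE.
  by rewrite iT.
by rewrite v0 // subr0.
Qed.

Lemma supp_restr u T : supp (restr u T) \subset T.
Proof.
by apply/fintype.subsetP=> i; rewrite inE mxE; case: (i \in T) => //; rewrite eqxx.
Qed.

Lemma sqnorm2_sub_restr u T : sqnorm2 (u - restr u T) = sqnorm2 u - mass u T.
Proof.
rewrite (sqnorm2_sub_supp u (supp_restr u T)) subrr sqnorm2E big1 ?add0r //.
by move=> i _; rewrite mxE expr0n.
Qed.

Lemma sparse_restr s u T : (#|T| <= s)%N -> sparse s (restr u T).
Proof. exact/leq_trans/subset_leq_card/supp_restr. Qed.

(* Shifting the squares by the smallest one on [T] makes them nonnegative on
   [T] and nonpositive off [T]. *)
Lemma top_set_mass_max s u T J :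
  T \in top_sets s u -> (#|J| <= s)%N -> mass u J <= mass u T.
Proof.
case/top_setsP=> cT topT cJ.
(* An empty [T] has no smallest entry; then [s] is 0 and [J] is empty too. *)
have [T0|[t0 t0T]] := finset.set_0Vmem T.
  move: cJ; rewrite -cT T0 cards0 leqn0 cards_eq0 => /eqP ->.
  by rewrite lexx.
case: (@arg_minP _ R _ t0 (mem T) (fun i => `|u 0 i|) t0T) => t tT tmin.
pose c i := u 0 i ^+ 2 - u 0 t ^+ 2.
have massE A : mass u A = \sum_(i in A) c i + u 0 t ^+ 2 *+ #|A|.
  by rewrite -sumr_const -big_split /=; apply: eq_bigr => i _; rewrite subrK.
have c_ge0 i : i \in T -> 0 <= c i.
  by move=> iT; rewrite subr_ge0 ler_sqr_norm tmin.
have c_le0 i : i \notin T -> c i <= 0.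
  by move=> iT; rewrite subr_le0 ler_sqr_norm topT.
(* The shift contributes a nonnegative multiple of the cardinality, and [#|J| <= #|T|]. *)
rewrite !massE; apply: lerD; last by rewrite ler_wpMn2l ?sqr_ge0 ?cT.
rewrite big_mkcond [leRHS]big_mkcond /=; apply: ler_sum => i _.
have [iT|/c_le0 iT] := boolP (i \in T); case: (i \in J) => //.
exact: c_ge0.
Qed.

(** Exchange argument: replacing [i] in [T] by [j] outside [T] keeps the size, so it cannot increase
    the mass; cancelling the common part [T :\ i] compares the two squares. *)
Lemma mass_max_top_set s u T : #|T| = s ->
  (forall J, #|J| = s -> mass u J <= mass u T) -> T \in top_sets s u.
Proof.
move=> cT maxT; apply/top_setsP; split=> // i j iT jT.
have jT' : j \notin T :\ i by rewrite inE (negbTE jT) andbF.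
have cJ : #|j |: (T :\ i)| = s.
  by rewrite cardsU1 jT' add1n -cT (cardsD1 i T) iT.
have := maxT _ cJ; rewrite /mass finset.big_setU1 //= (big_setD1 i iT) /= lerD2r.
by rewrite ler_sqr_norm.
Qed.

Lemma exists_top_set s u : (s <= n)%N -> exists T, T \in top_sets s u.
Proof.
move=> lesn.
have [|T0 _ /eqP cT0] := @exists_superset_card _ (finset.set0 : {set 'I_n}) s.
  by rewrite cards0 card_ord.
case: (@arg_maxP _ R _ T0 (fun T => #|T| == s) (mass u) cT0) => T /eqP cT maxT.
by exists T; apply: mass_max_top_set => // J /eqP; apply: maxT.
Qed.

Lemma proj_sparseP s u w : (s <= n)%N ->
  proj_sparse s u w <-> exists2 T, T \in top_sets s u & w = restr u T.
Proof.
move=> lesn; split=> [[sw minw]|[T topT ->]]; last first.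
  have [cT _] := top_setsP _ _ _ topT.
  split=> [|v sv]; first by apply: sparse_restr; rewrite cT.
  rewrite sqnorm2_sub_restr (sqnorm2_sub_supp u (subxx (supp v))).
  apply: (@le_trans _ _ (sqnorm2 u - mass u (supp v))).
    by rewrite lerD2l lerN2; apply: top_set_mass_max sv.
  by rewrite lerDr sqnorm2_ge0.
(* The support of [w] may have fewer than [s] elements, so it is first enlarged to size [s]. *)
have [|T swT cT] := @exists_superset_card _ (supp w) s.
  by rewrite card_ord lesn andbT.
(* Here [w] is compared with the competitor [restr u J]. Taking [J = T] forces [w = restr u T]; the
   other [J] show that [T] has maximal mass. *)
have minT J : #|J| = s ->
    sqnorm2 (restr u T - w) + mass u J <= mass u T.
  move=> cJ; have := minw _ (sparse_restr u (eq_leq cJ)).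
  rewrite sqnorm2_sub_restr (sqnorm2_sub_supp u swT).
  by rewrite addrCA lerD2l lerBlDr [- _ + _]addrC lerBrDr.
have wE : w = restr u T.
  have := minT T cT; rewrite gerDr => le0.
  apply/esym/eqP; rewrite -subr_eq0; apply/eqP/sqnorm2_eq0/eqP.
  by rewrite eq_le le0 sqnorm2_ge0.
exists T => //; apply: mass_max_top_set => // J /minT.
by apply: le_trans; rewrite lerDr sqnorm2_ge0.
Qed.

Lemma restr_stepP x g beta T : beta != 0 ->
  x = restr (x - beta *: g) T <->
  (forall i, i \in T -> g 0 i = 0) /\ (forall i, i \notin T -> x 0 i = 0).
Proof.
move=> beta0; split=> [xE|[g0 x0]].
  split=> i iT; have := congr1 (fun v : 'rV_n => v 0 i) xE.
    rewrite !mxE iT => /esym/eqP; rewrite -subr_eq0 addrAC subrr add0r oppr_eq0.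
    by rewrite mulf_eq0 (negbTE beta0) => /eqP.
  by rewrite mxE (negbTE iT).
apply/rowP=> i; rewrite !mxE; case: ifPn => iT; last exact: x0.
by rewrite g0 // mulr0 subr0.
Qed.

(* If a set [J] of size [s] containing [supp x] differs from a top set, then
   [u] vanishes at some index of that top set, hence [u] vanishes off [J]. *)
Lemma top_sets_supp s u x : (s <= n)%N ->
  (forall T, T \in top_sets s u -> x = restr u T) ->
  top_sets s u = Jsx s x.
Proof.
move=> lesn xE; apply/finset.setP=> J; apply/idP/idP=> [topJ|].
  have [cJ _] := top_setsP _ _ _ topJ.
  by rewrite !inE cJ eqxx (xE J topJ) supp_restr.
rewrite !inE => /andP[/eqP cJ /fintype.subsetP sxJ].
have [T topT] := exists_top_set u lesn.
have [cT leT] := top_setsP _ _ _ topT.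
have [sTJ|] := boolP (T \subset J).
  suff <- : T = J by move: topT; rewrite !inE.
  by apply/eqP; rewrite eqEcard sTJ cT cJ /=.
have x_u i : i \in T -> x 0 i = u 0 i.
  by move=> iT; rewrite (xE T topT) mxE iT.
have x0 i : i \notin J -> x 0 i = 0.
  by apply: contraNeq => xi; apply: sxJ; rewrite inE.
case/fintype.subsetPn=> k kT kJ; have uk : u 0 k = 0 by rewrite -x_u // x0.
suff : J \in top_sets s u by rewrite !inE.
apply/top_setsP; split=> // i j iJ jJ; suff -> : u 0 j = 0 by rewrite normr0.
(* In [T], [u] agrees with [x], which vanishes off [J]; outside [T], [u] is dominated by its zero
   entry at [k]. *)
have [jT|jT] := boolP (j \in T); first by rewrite -x_u // x0.
by apply/eqP; have := leT k j kT jT; rewrite uk normr0 normr_le0.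
Qed.

End SparseProjection.

Section StationaryEquations.
Context {R : realType} {n m : nat}.
Implicit Types (x : 'rV[R]_n) (y : 'rV[R]_m) (T : {set 'I_n}).

Lemma subvec_eq0 T x : subvec T x = 0 <-> (forall i, i \in T -> x 0 i = 0).
Proof.
split=> [x0 i iT|x0]; last by apply/rowP=> k; rewrite !mxE x0 // enum_valP.
have := congr1 (fun v : 'rV_#|T| => v 0 (enum_rank_in iT i)) x0.
by rewrite !mxE enum_rankK_in.
Qed.

Lemma FF_eq0 (f : 'rV[R]_n -> R) (h : 'rV[R]_n -> 'rV[R]_m) beta x y T :
  beta != 0 ->
  FF f h x y T = 0 <->
  x = restr (x - beta *: grad_lagrangian f h x y) T /\ h x = 0.
Proof.
move=> beta0; rewrite restr_stepP //; split.
  move/eqP; rewrite !row_mx_eq0 oppr_eq0 => /andP[/andP[/eqP g0 /eqP x0] /eqP h0].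
  split=> //; split; first exact/subvec_eq0.
  by move=> i iT; apply: ((subvec_eq0 _ _).1 x0); rewrite inE.
case=> [[/subvec_eq0 g0 x0] h0]; apply/eqP.
rewrite !row_mx_eq0 oppr_eq0 g0 h0 !eqxx andbT /=; apply/eqP/subvec_eq0 => i.
by rewrite inE; apply: x0.
Qed.

End StationaryEquations.

Theorem theorem3p2 (R : realType) (n m s : nat)
    (hm : (0 < m)%N) (hs : (0 < s)%N) (hsn : (s < n)%N)
    (f : 'rV[R]_n -> R) (h : 'rV[R]_n -> 'rV[R]_m)
    (hf : is_C2 f) (hh : is_C2 h)
    (x : 'rV[R]_n) (y : 'rV[R]_m) (beta : R)
    (hx : sparse s x) (hbeta : 0 < beta) :
  (strong_stationary f h s beta x y <->
     (forall T : {set 'I_n}, T \in TT f h s x y beta -> FF f h x y T = 0))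
  /\ (strong_stationary f h s beta x y -> TT f h s x y beta = Jsx s x).
Proof.
have lesn := ltnW hsn; have beta0 := lt0r_neq0 hbeta.
pose u := x - beta *: grad_lagrangian f h x y.
rewrite -[TT f h s x y beta]/(top_sets s u).
have xE : strong_stationary f h s beta x y ->
    forall T, T \in top_sets s u -> x = restr u T.
  move=> [projE _] T topT; apply/esym.
  suff : [set x]%classic (restr u T) by [].
  by rewrite -projE; apply/proj_sparseP => //; exists T.
split; last by move=> /xE; apply: top_sets_supp.
split=> [st T topT|FF0].
  by apply/(FF_eq0 _ _ _ _ _ beta0); split; [exact: xE | exact: st.2].
have {}FF0 T : T \in top_sets s u -> x = restr u T /\ h x = 0.
  by move=> /FF0 /(FF_eq0 _ _ _ _ _ beta0).
(* Without some top set [FF0] could hold vacuously; this one yields both feasibility and the fact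
   that [x] is itself a projection. *)
have [T topT] := exists_top_set u lesn; have [xT h0] := FF0 T topT.
split=> //; apply/seteqP; split=> [w /(proj_sparseP _ _ lesn)[J topJ ->]|w ->].
  by rewrite /= -(FF0 J topJ).1.
by apply/proj_sparseP => //; exists T.
Qed.
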